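(* Let $H:\mathbb{R}\to\mathbb{R}$ be a continuously differentiable, 1-periodic, positive function. Then the following identities hold: 1. $\big\langle H^{-3}\,([\![\,[\![H^{-1}]\!]\,]\!])^2\,H'\big\rangle=\big\langle H^{-1}\,[\![\,[\![\,H^{-3}\,[\![\,[\![H^{-1}]\!]\,]\!]\,H'\,]\!]\,]\!]\big\rangle$; 2. $\big\langle H^{-1}\,[\![\,[\![\,H^{-3}\,[\![H^{-2}]\!]\,H'\,]\!]\,]\!]\big\rangle=-\big\langle[\![H^{-1}]\!]\,[\![\,H^{-3}\,[\![H^{-2}]\!]\,H'\,]\!]\big\rangle=\big\langle H^{-3}\,[\![H^{-2}]\!]\,[\![\,[\![H^{-1}]\!]\,]\!]\,H'\big\rangle$; 3. $\big\langle H^{-2}\,[\![\,H^{-4}\,[\![H^{-1}]\!]\,H'\,]\!]\big\rangle=-\big\langle H^{-4}\,[\![H^{-2}]\!]\,[\![H^{-1}]\!]\,H'\big\rangle$.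
   Context: For a continuous 1-periodic function $g:\mathbb{R}\to\mathbb{R}$ define its average over one period $\langle g\rangle:=\int_0^1 g(y)\,dy$, its fluctuating part $\{g\}(y):=g(y)-\langle g\rangle$, and, for all $y\in\mathbb{R}$, $$[\![g]\!](y):=\int_0^y\{g\}(\xi)\,d\xi-\int_0^1\int_0^\tau\{g\}(\xi)\,d\xi\,d\tau .$$ Powers such as $H^{-k}$ are pointwise, $H^{-k}(y)=H(y)^{-k}$, juxtaposition is the pointwise product of functions, and $H'$ is the derivative of $H$. *)

(* Defs.v *)
From Stdlib Require Import Reals.
From Coquelicot Require Import Coquelicot.
Open Scope R_scope.

(** Stdlib reals with Coquelicot's total integral [RInt] and derivative
    [Derive].  The operators below are total on [R -> R]; they have their
    intended meaning on continuous 1-periodic functions. *)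

Definition periodic1 (g : R -> R) : Prop := forall y : R, g (y + 1) = g y.

Definition continuously_differentiable (g : R -> R) : Prop :=
  (forall y : R, ex_derive g y) /\ (forall y : R, continuous (Derive g) y).

Definition average (g : R -> R) : R := RInt g 0 1.

Definition fluctuation (g : R -> R) : R -> R := fun y => g y - average g.

(** The zero-average primitive of the fluctuating part; [y] may be negative,
    [RInt] being oriented. *)
Definition bracket (g : R -> R) : R -> R := fun y =>
  RInt (fluctuation g) 0 y
  - RInt (fun tau => RInt (fluctuation g) 0 tau) 0 1.

Definition fmul (f g : R -> R) : R -> R := fun y => f y * g y.

Definition fpow (f : R -> R) (k : nat) : R -> R := fun y => f y ^ k.

(** [inv_pow H k] is the pointwise power [H^{-k}], not an iterate or a
    functional inverse. *)
Definition inv_pow (H : R -> R) (k : nat) : R -> R := fun y => / (H y ^ k).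

Declare Scope periodic_scope.
Delimit Scope periodic_scope with per.
Notation "⟨ g ⟩" := (average g%per) (at level 0, g at level 99) : R_scope.
Notation "⟦ g ⟧" := (bracket g%per) (at level 0, g at level 99)
  : periodic_scope.
Notation "f ⋅ g" := (fmul f%per g%per) (at level 40, left associativity)
  : periodic_scope.
Notation "H ^- k" := (inv_pow H k%nat) (at level 30, right associativity)
  : periodic_scope.
Notation "f ^ k" := (fpow f%per k%nat) : periodic_scope.

(* Main.v *)
(** [bracket] is antisymmetric for the pairing
    [(f, g) |-> average (fmul f g)]: [bracket f] and [bracket g] are
    zero-average primitives of the fluctuating parts with equal values at [0]
    and [1], so integrating the derivative of their product over a period gives
    [0].  Each identity moves one or two brackets across the average. *)

Require Import Defs.
From Stdlib Require Import Reals Lra.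
From Coquelicot Require Import Coquelicot.
Open Scope R_scope.

Lemma ex_RInt_of_continuous (f : R -> R) (a b : R) :
  (forall y, continuous f y) -> ex_RInt f a b.
Proof. intros cf; apply (ex_RInt_continuous (V := R_CompleteNormedModule)); auto. Qed.

Lemma is_RInt_average (f : R -> R) :
  (forall y, continuous f y) -> is_RInt f 0 1 (average f).
Proof.
  intros cf; apply (RInt_correct (V := R_CompleteNormedModule)).
  now apply ex_RInt_of_continuous.
Qed.

Lemma average_ext (f g : R -> R) :
  (forall y, f y = g y) -> average f = average g.
Proof. intros e; apply RInt_ext; auto. Qed.

Lemma continuous_fmul (f g : R -> R) :
  (forall y, continuous f y) -> (forall y, continuous g y) ->
  forall y, continuous (fmul f g) y.
Proof. intros cf cg y; now apply (continuous_mult (K := R_AbsRing)). Qed.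

Lemma continuous_fluctuation (g : R -> R) :
  (forall y, continuous g y) -> forall y, continuous (fluctuation g) y.
Proof.
  intros cg y; apply (continuous_minus (V := R_NormedModule)); [apply cg |].
  apply continuous_const.
Qed.

Lemma is_derive_RInt_upper (g : R -> R) (y : R) :
  (forall x, continuous g x) -> is_derive (fun x => RInt g 0 x) y (g y).
Proof.
  intros cg; apply (is_derive_RInt (V := R_NormedModule) g _ 0 y); [| apply cg].
  apply filter_forall; intros x.
  apply (RInt_correct (V := R_CompleteNormedModule)).
  now apply ex_RInt_of_continuous.
Qed.

Lemma is_derive_bracket (g : R -> R) (y : R) :
  (forall x, continuous g x) -> is_derive (bracket g) y (fluctuation g y).
Proof.
  intros cg.
  (* The subtracted [0] is the derivative of the constant term of the bracket, so the value takes
     the shape of the rule for differences. *)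
  replace (fluctuation g y) with (minus (fluctuation g y) 0)
    by (unfold minus, plus, opp; simpl; ring).
  apply (is_derive_minus (V := R_NormedModule));
    [| exact (is_derive_const (V := R_NormedModule) _ y)].
  apply is_derive_RInt_upper; now apply continuous_fluctuation.
Qed.

Lemma continuous_bracket (g : R -> R) :
  (forall x, continuous g x) -> forall y, continuous (bracket g) y.
Proof.
  intros cg y; apply (ex_derive_continuous (V := R_NormedModule)).
  exists (fluctuation g y); now apply is_derive_bracket.
Qed.

Lemma average_minus_const (f : R -> R) (c : R) :
  (forall y, continuous f y) -> average (fun y => f y - c) = average f - c.
Proof.
  intros cf; unfold average.
  rewrite (RInt_minus (V := R_CompleteNormedModule) f (fun _ => c));
    [| now apply ex_RInt_of_continuous | apply ex_RInt_const].
  rewrite RInt_const; unfold minus, plus, opp, scal; simpl; unfold mult; simpl; ring.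
Qed.

(** The constant subtracted in [bracket g] is exactly the average of the primitive in front of
    it. *)
Lemma average_bracket (g : R -> R) :
  (forall y, continuous g y) -> average (bracket g) = 0.
Proof.
  intros cg; unfold bracket.
  rewrite (average_minus_const (fun y => RInt (fluctuation g) 0 y)).
  - unfold average; ring.
  - intros y; apply (ex_derive_continuous (V := R_NormedModule)).
    exists (fluctuation g y); apply is_derive_RInt_upper.
    now apply continuous_fluctuation.
Qed.

(** The increment from 0 to 1 is the integral of [fluctuation g], which vanishes because the
    interval has length 1. *)
Lemma bracket_0_1 (g : R -> R) :
  (forall y, continuous g y) -> bracket g 1 = bracket g 0.
Proof.
  intros cg; unfold bracket; rewrite RInt_point.
  replace (RInt (fluctuation g) 0 1) with 0; [reflexivity |].
  symmetry; etransitivity; [exact (average_minus_const g (average g) cg) | ring].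
Qed.

(** Brackets differentiate to fluctuating parts rather than to [f] and [g]. The discrepancy is
    [average f] times [bracket g] plus [average g] times [bracket f], whose average is zero. *)
Lemma average_fmul_bracket (f g : R -> R) :
  (forall y, continuous f y) -> (forall y, continuous g y) ->
  average (fmul f (bracket g)) = - average (fmul (bracket f) g).
Proof.
  intros cf cg.
  assert (cF := continuous_bracket f cf).
  assert (cG := continuous_bracket g cg).
  assert (I1 : is_RInt (fmul f (bracket g)) 0 1 (average (fmul f (bracket g)))).
  { apply is_RInt_average; auto using continuous_fmul. }
  assert (I2 : is_RInt (fmul (bracket f) g) 0 1 (average (fmul (bracket f) g))).
  { apply is_RInt_average; auto using continuous_fmul. }
  (* In the rewrite, [at 2] selects the value of the integral; the first [0] is the lower limit. *)
  assert (IF : is_RInt (bracket f) 0 1 0).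
  { rewrite <- (average_bracket f cf) at 2; apply is_RInt_average; auto. }
  assert (IG : is_RInt (bracket g) 0 1 0).
  { rewrite <- (average_bracket g cg) at 2; apply is_RInt_average; auto. }
  (* The subtracted terms integrate to zero by [IG] and [IF], so the value of [J] is the sum of the
     two averages to be compared. *)
  assert (J := is_RInt_minus _ _ _ _ _ _ (is_RInt_plus _ _ _ _ _ _ I1 I2)
    (is_RInt_plus _ _ _ _ _ _ (is_RInt_scal _ _ _ (average f) _ IG)
       (is_RInt_scal _ _ _ (average g) _ IF))).
  assert (D : is_RInt
    (fun y => fluctuation f y * bracket g y + bracket f y * fluctuation g y) 0 1
    (bracket f 1 * bracket g 1 - bracket f 0 * bracket g 0)).
  { apply (is_RInt_derive (V := R_CompleteNormedModule)
      (fun y => bracket f y * bracket g y)).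
    - intros y _; apply (is_derive_mult (K := R_AbsRing));
        [now apply is_derive_bracket | now apply is_derive_bracket | apply Rmult_comm].
    - intros y _; apply (continuous_plus (V := R_NormedModule));
        apply (continuous_mult (K := R_AbsRing)); auto using continuous_fluctuation. }
  (* The boundary terms cancel, so the integral in [D] is 0. *)
  rewrite !bracket_0_1, Rminus_diag in D by assumption.
  (* The integrands of [J] and [D] agree pointwise, hence the sum of averages is 0. *)
  apply (is_RInt_ext _ (fun y => fluctuation f y * bracket g y
    + bracket f y * fluctuation g y)) in J.
  - apply (is_RInt_unique (V := R_CompleteNormedModule)) in D, J.
    rewrite D in J; unfold minus, plus, opp, scal in J; simpl in J.
    unfold mult in J; simpl in J; lra.
  - intros y _; unfold fmul, fluctuation, minus, plus, opp, scal; simpl.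
    unfold mult; simpl; ring.
Qed.

(** Each of the two brackets crosses the product with a sign, and the signs cancel. *)
Lemma average_fmul_bracket_bracket (f g : R -> R) :
  (forall y, continuous f y) -> (forall y, continuous g y) ->
  average (fmul f (bracket (bracket g))) = average (fmul (bracket (bracket f)) g).
Proof.
  intros cf cg.
  rewrite average_fmul_bracket, average_fmul_bracket, Ropp_involutive;
    auto using continuous_bracket.
Qed.

Theorem proposition8 (H : R -> R)
  (H_C1 : continuously_differentiable H)
  (H_per : periodic1 H)
  (H_pos : forall y : R, 0 < H y) :
  (⟨ H ^- 3 ⋅ ⟦ ⟦ H ^- 1 ⟧ ⟧ ^ 2 ⋅ Derive H ⟩
   = ⟨ H ^- 1 ⋅ ⟦ ⟦ H ^- 3 ⋅ ⟦ ⟦ H ^- 1 ⟧ ⟧ ⋅ Derive H ⟧ ⟧ ⟩)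
  /\
  (⟨ H ^- 1 ⋅ ⟦ ⟦ H ^- 3 ⋅ ⟦ H ^- 2 ⟧ ⋅ Derive H ⟧ ⟧ ⟩
   = - ⟨ ⟦ H ^- 1 ⟧ ⋅ ⟦ H ^- 3 ⋅ ⟦ H ^- 2 ⟧ ⋅ Derive H ⟧ ⟩
   /\
   - ⟨ ⟦ H ^- 1 ⟧ ⋅ ⟦ H ^- 3 ⋅ ⟦ H ^- 2 ⟧ ⋅ Derive H ⟧ ⟩
   = ⟨ H ^- 3 ⋅ ⟦ H ^- 2 ⟧ ⋅ ⟦ ⟦ H ^- 1 ⟧ ⟧ ⋅ Derive H ⟩)
  /\
  (⟨ H ^- 2 ⋅ ⟦ H ^- 4 ⋅ ⟦ H ^- 1 ⟧ ⋅ Derive H ⟧ ⟩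
   = - ⟨ H ^- 4 ⋅ ⟦ H ^- 2 ⟧ ⋅ ⟦ H ^- 1 ⟧ ⋅ Derive H ⟩).
Proof.
  destruct H_C1 as [dH cdH].
  assert (c_inv : forall k y, continuous (inv_pow H k) y).
  { intros k y; apply continuous_comp with (g := fun x => / (x ^ k)).
    - apply (ex_derive_continuous (V := R_NormedModule)), dH.
    - apply (ex_derive_continuous (V := R_NormedModule)); auto_derive.
      (* Positivity of [H] keeps the denominator away from zero. *)
      apply pow_nonzero, Rgt_not_eq, H_pos. }
  (* This covers every product with [Derive H] that stands under a bracket; the double bracket
     arises when [g] is itself a bracket. *)
  assert (c_w : forall j g, (forall y, continuous g y) ->
    forall y, continuous (fmul (fmul (inv_pow H j) (bracket g)) (Derive H)) y).
  { auto 6 using continuous_bracket, continuous_fmul. }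
  repeat split.
  (* Moving both outer brackets on the right onto [H ^- 1] produces the second factor of the
     square. *)
  - rewrite average_fmul_bracket_bracket; auto using continuous_bracket, continuous_fmul.
    apply average_ext; intros y; unfold fmul, fpow; ring.
  - apply average_fmul_bracket; auto using continuous_bracket, continuous_fmul.
  (* The first rewrite returns to the leftmost member of the chain; from there both brackets move
     onto [H ^- 1]. *)
  - rewrite <- average_fmul_bracket, average_fmul_bracket_bracket;
      auto using continuous_bracket, continuous_fmul.
    apply average_ext; intros y; unfold fmul; ring.
  - rewrite average_fmul_bracket; auto using continuous_bracket, continuous_fmul.
    apply f_equal, average_ext; intros y; unfold fmul; ring.
Qed.
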